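(* Let $\mathcal{G}$ be a connected groupoid, $x\in\mathcal{G}_0$, $\tau(x)=\{\tau_y\}_{y\in\mathcal{G}_0}$ a transversal for $x$, $A$ a ring, and $(I,\gamma_{\tau(x)},\gamma_{(x)})$ an object of $\mathsf{D}_{\mathcal{G},\tau(x)}(A)$. For $g\in\mathcal{G}$ define the partial bijection $$\theta_g=\begin{cases}\mathrm{id}_{I_y}, & \text{if } g=y\in\mathcal{G}_0,\\ \gamma_{\tau_{t(g)}}\,\gamma_{g_x}\,\gamma_{\tau_{s(g)}}^{-1}, & \text{if } g\notin\mathcal{G}_0,\end{cases}$$ (composition of partial bijections of $A$), and let $B_g$ be the range of $\theta_g$; thus $B_y=I_y$ for $y\in\mathcal{G}_0$ and $B_g=\gamma_{\tau_{t(g)}}\big(I_{\tau_{t(g)}^{-1}}\cap\gamma_{g_x}(I_{\tau_{s(g)}^{-1}}\cap I_{g_x^{-1}})\big)$ for $g\notin\mathcal{G}_0$. Then $\theta=(B_g,\theta_g)_{g\in\mathcal{G}}$ is a partial action of $\mathcal{G}$ on $A$.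
   Context: Rings are associative and not necessarily unital; ideals are two-sided. A groupoid $\mathcal{G}$ is a small category in which every morphism is an isomorphism; $g\in\mathcal{G}$ means $g$ is a morphism; $\mathcal{G}_0$ is the set of objects, each object being identified with its identity morphism; $s(g),t(g)$ are source and target; composition is written right to left, so $gh$ is defined iff $s(g)=t(h)$. $\mathcal{G}(x,y)=\{g\in\mathcal{G}: s(g)=x,\ t(g)=y\}$ and $\mathcal{G}(x)=\mathcal{G}(x,x)$ is the isotropy group. $\mathcal{G}$ is connected if $\mathcal{G}(x,y)\neq\emptyset$ for all $x,y\in\mathcal{G}_0$. A partial action of $\mathcal{G}$ on a ring $A$ is a family $\alpha=(A_g,\alpha_g)_{g\in\mathcal{G}}$ such that: (P1) for each $g$, $A_{t(g)}$ is an ideal of $A$, $A_g$ is an ideal of $A_{t(g)}$ and $\alpha_g:A_{g^{-1}}\to A_g$ is a ring isomorphism; (P2) $\alpha_x=\mathrm{id}_{A_x}$ for $x\in\mathcal{G}_0$; (P3) $\alpha_h^{-1}(A_{g^{-1}}\cap A_h)\subseteq A_{(gh)^{-1}}$ whenever $s(g)=t(h)$; (P4) $\alpha_g(\alpha_h(a))=\alpha_{gh}(a)$ for all $a\in\alpha_h^{-1}(A_{g^{-1}}\cap A_h)$ whenever $s(g)=t(h)$. A partial action of a group $H$ on a ring $I$ is a partial action of $H$ viewed as a one-object groupoid, the ideal attached to the identity of $H$ being $I$ itself. A transversal for $x\in\mathcal{G}_0$ is a family $\tau(x)=\{\tau_y\}_{y\in\mathcal{G}_0}$ with $\tau_y\in\mathcal{G}(x,y)$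 and $\tau_x=x$. For $g\in\mathcal{G}$ put $g_x:=\tau_{t(g)}^{-1}g\tau_{s(g)}\in\mathcal{G}(x)$. Composition of partial bijections $f:X\to Y$, $f':X'\to Y'$ of a set is $f'f:f^{-1}(X'\cap Y)\to f'(X'\cap Y)$. An object of $\mathsf{D}_{\mathcal{G},\tau(x)}(A)$ is a triple $(I,\gamma_{\tau(x)},\gamma_{(x)})$ where: $I=\{I_y\}_{y\in\mathcal{G}_0}$ is a family of ideals of $A$; $\gamma_{\tau(x)}=\{\gamma_{\tau_y}:I_{\tau_y^{-1}}\to I_{\tau_y}\}_{y\in\mathcal{G}_0}$ is a family of ring isomorphisms with $I_{\tau_y^{-1}}$ an ideal of $I_x$, $I_{\tau_y}$ an ideal of $I_y$, and $\gamma_{\tau_x}=\gamma_x=\mathrm{id}_{I_x}$; $\gamma_{(x)}=(I_h,\gamma_h)_{h\in\mathcal{G}(x)}$ is a partial action of the group $\mathcal{G}(x)$ on $I_x$; and for all $g\in\mathcal{G}$ the set $\gamma_{\tau_{t(g)}}\big(I_{\tau_{t(g)}^{-1}}\cap\gamma_{g_x}(I_{\tau_{s(g)}^{-1}}\cap I_{g_x^{-1}})\big)$ is an ideal of $I_{t(g)}$. *)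

(* Defs.v *)
From HB Require Import structures.
From mathcomp Require Import all_boot all_algebra.
From mathcomp Require Import boolp classical_sets functions.

Set Implicit Arguments.
Unset Strict Implicit.
Unset Printing Implicit Defensive.

Import GRing.Theory.

Local Open Scope classical_set_scope.
Local Open Scope ring_scope.

(* Associative rings without a unit, commutativity or nontriviality axiom. *)
HB.mixin Record Zmodule_isRng A of GRing.Zmodule A := {
  rmul : A -> A -> A;
  rmulA : associative rmul;
  rmulDl : left_distributive rmul +%R;
  rmulDr : right_distributive rmul +%R
}.

#[short(type="rngType")]
HB.structure Definition Rng := { A of Zmodule_isRng A & GRing.Zmodule A }.

(* J is a two-sided ideal of S; S is meant to be a subring of A, and
   S = [set: A] gives the ideals of A. *)
Record is_ideal (A : rngType) (S J : set A) : Prop := IsIdeal {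
  ideal_sub : J `<=` S;
  ideal0 : J 0;
  idealB : forall a b, J a -> J b -> J (a - b);
  idealMl : forall r a, S r -> J a -> J (rmul r a);
  idealMr : forall r a, S r -> J a -> J (rmul a r)
}.

(* Partial bijections of T, from pb_dom onto pb_rng. The values of pb_fun
   outside pb_dom are irrelevant, hence pbij_eq below. *)
Record pbij (T : Type) := PBij {
  pb_dom : set T;
  pb_rng : set T;
  pb_fun :> T -> T;
  pb_bij : set_bij pb_dom pb_rng pb_fun
}.

Definition pbij_eq (T : Type) (f f' : pbij T) : Prop :=
  pb_dom f = pb_dom f' /\ forall a, pb_dom f a -> f a = f' a.

Lemma pb_id_bij (T : Type) (S : set T) : set_bij S S id.
Proof. by split=> // a Sa; exists a. Qed.

Definition pb_id (T : Type) (S : set T) : pbij T := PBij (pb_id_bij S).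

Definition pb_inv (T : Type) (f : pbij T) : pbij T :=
  PBij (bijpinv_bij id (pb_bij f)).

Lemma pb_comp_bij (T : Type) (f' f : pbij T) :
  set_bij (pb_dom f `&` f @^-1` (pb_dom f' `&` pb_rng f))
          (f' @` (pb_dom f' `&` pb_rng f)) (f' \o f).
Proof.
have [_ injf surjf] := pb_bij f; have [_ injf' _] := pb_bij f'.
split.
- by move=> a [_ ab]; exists (f a).
- move=> a b /set_mem[da [fa _]] /set_mem[db [fb _]] eqab.
  by apply: injf; rewrite ?inE //; apply: injf'; rewrite ?inE.
- move=> _ [b [d'b rb] <-]; have [a da fab] := surjf _ rb.
  by exists a; rewrite /= ?fab.
Qed.

Definition pb_comp (T : Type) (f' f : pbij T) : pbij T :=
  PBij (pb_comp_bij f' f).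

Definition ring_iso (A : rngType) (J K : set A) (f : pbij A) : Prop :=
  [/\ pb_dom f = J, pb_rng f = K,
      forall a b, J a -> J b -> f (a + b) = f a + f b
    & forall a b, J a -> J b -> f (rmul a b) = rmul (f a) (f b)].

(* [gcomp g h] is the composite gh, written right to left. *)
Record groupoid := Groupoid {
  gobj : Type;
  ghom : gobj -> gobj -> Type;
  gid : forall y, ghom y y;
  gcomp : forall y z w, ghom z w -> ghom y z -> ghom y w;
  ginv : forall y z, ghom y z -> ghom z y;
  gcompA : forall y z w v (f : ghom w v) (g : ghom z w) (h : ghom y z),
    gcomp f (gcomp g h) = gcomp (gcomp f g) h;
  gcomp1g : forall y z (g : ghom y z), gcomp (gid z) g = g;
  gcompg1 : forall y z (g : ghom y z), gcomp g (gid y) = g;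
  gcompVg : forall y z (g : ghom y z), gcomp (ginv g) g = gid y;
  gcompgV : forall y z (g : ghom y z), gcomp g (ginv g) = gid z
}.

Arguments gid {g0} y.
Arguments gcomp {g0 y z w}.
Arguments ginv {g0 y z}.

(* [is_identity g] says that g belongs to the set of objects, each object
   being identified with its identity morphism. *)
Variant is_identity (G : groupoid) :
    forall y z : gobj G, ghom y z -> Prop :=
  IsIdentity (y : gobj G) : is_identity (gid y).

Definition groupoid_connected (G : groupoid) : Prop :=
  forall y z : gobj G, inhabited (ghom y z).

Definition isotropy (G : groupoid) (x : gobj G) : groupoid :=
  @Groupoid unit (fun _ _ => ghom x x) (fun _ => gid x)
    (fun _ _ _ g h => gcomp g h) (fun _ _ g => ginv g)
    (fun _ _ _ _ f g h => gcompA f g h) (fun _ _ g => gcomp1g g)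
    (fun _ _ g => gcompg1 g) (fun _ _ g => gcompVg g)
    (fun _ _ g => gcompgV g).

(* [(D, alpha)] is a partial action of G on the subring S of A; a partial
   action on A itself is the case S = [set: A]. *)
Record partial_action (G : groupoid) (A : rngType) (S : set A)
    (D : forall y z : gobj G, ghom y z -> set A)
    (alpha : forall y z : gobj G, ghom y z -> pbij A) : Prop := PartialAction {
  pa_obj_ideal : forall y : gobj G, is_ideal S (D y y (gid y));
  pa_ideal : forall (y z : gobj G) (g : ghom y z),
    is_ideal (D z z (gid z)) (D y z g);
  pa_iso : forall (y z : gobj G) (g : ghom y z),
    ring_iso (D z y (ginv g)) (D y z g) (alpha y z g);
  pa_id : forall y : gobj G,
    pbij_eq (alpha y y (gid y)) (pb_id (D y y (gid y)));
  pa_dom : forall (y z w : gobj G) (g : ghom z w) (h : ghom y z),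
    D z y (ginv h) `&` alpha y z h @^-1` (D w z (ginv g) `&` D y z h)
      `<=` D w y (ginv (gcomp g h));
  pa_comp : forall (y z w : gobj G) (g : ghom z w) (h : ghom y z) (a : A),
    D z y (ginv h) a -> (D w z (ginv g) `&` D y z h) (alpha y z h a) ->
    alpha z w g (alpha y z h a) = alpha y w (gcomp g h) a
}.

Definition isotropy_partial_action (G : groupoid) (x : gobj G) (A : rngType)
    (S : set A) (D : ghom x x -> set A) (alpha : ghom x x -> pbij A) : Prop :=
  @partial_action (isotropy x) A S (fun _ _ => D) (fun _ _ => alpha) /\
  D (gid x) = S.

Record transversal_at (G : groupoid) (x : gobj G) := TransversalAt {
  tau :> forall y : gobj G, ghom x y;
  tau_id : tau x = gid x
}.

Definition to_isotropy (G : groupoid) (x : gobj G) (tx : transversal_at x)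
    (y z : gobj G) (g : ghom y z) : ghom x x :=
  gcomp (gcomp (ginv (tx z)) g) (tx y).

(* The data of a triple (I, gamma_tau(x), gamma_(x)):
   dat_ideal y   = I_y,
   dat_tau_dom y = I_(tau_y^-1),
   dat_tau_rng y = I_(tau_y),
   dat_tau y     = gamma_(tau_y),
   dat_iso_set h = I_h and dat_iso h = gamma_h for h in G(x). *)
Record datum (G : groupoid) (x : gobj G) (A : rngType) := Datum {
  dat_ideal : gobj G -> set A;
  dat_tau_dom : gobj G -> set A;
  dat_tau_rng : gobj G -> set A;
  dat_tau : gobj G -> pbij A;
  dat_iso_set : ghom x x -> set A;
  dat_iso : ghom x x -> pbij A
}.

Definition transported_set (G : groupoid) (x : gobj G) (A : rngType)
    (tx : transversal_at x) (X : datum x A)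
    (y z : gobj G) (g : ghom y z) : set A :=
  let gx := to_isotropy tx g in
  dat_tau X z @` (dat_tau_dom X z `&`
    dat_iso X gx @` (dat_tau_dom X y `&` dat_iso_set X (ginv gx))).

Record is_D_object (G : groupoid) (x : gobj G) (A : rngType)
    (tx : transversal_at x) (X : datum x A) : Prop := IsDObject {
  D_ideal : forall y, is_ideal [set: A] (dat_ideal X y);
  D_tau_dom : forall y, is_ideal (dat_ideal X x) (dat_tau_dom X y);
  D_tau_rng : forall y, is_ideal (dat_ideal X y) (dat_tau_rng X y);
  D_tau_iso : forall y,
    ring_iso (dat_tau_dom X y) (dat_tau_rng X y) (dat_tau X y);
  D_tau_id : pbij_eq (dat_tau X x) (pb_id (dat_ideal X x));
  D_iso : isotropy_partial_action (dat_ideal X x)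
            (dat_iso_set X) (dat_iso X);
  D_transported : forall (y z : gobj G) (g : ghom y z),
    is_ideal (dat_ideal X z) (transported_set tx X g)
}.

Definition theta (G : groupoid) (x : gobj G) (A : rngType)
    (tx : transversal_at x) (X : datum x A)
    (y z : gobj G) (g : ghom y z) : pbij A :=
  if `[< is_identity g >] then pb_id (dat_ideal X z)
  else pb_comp (dat_tau X z)
         (pb_comp (dat_iso X (to_isotropy tx g)) (pb_inv (dat_tau X y))).

(* Main.v *)
(* The graph of [theta g] is the relational composite of the graph of the
   inverse of [gamma_(tau_s(g))] with the graphs of [gamma_(g_x)] and of
   [gamma_(tau_t(g))], except when [g] is an identity, where [theta g] may only
   be larger than this composite. Since [gamma_(tau_y)] is injective and
   [(gh)_x = g_x h_x], such composites are compatible with composition and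
   inversion because the partial action of the isotropy group is; this gives
   (P3) and (P4). Graphs of ring isomorphisms are closed under sum and product,
   hence so are their composites. *)
Require Import Defs.
From HB Require Import structures.
From mathcomp Require Import all_boot all_algebra.
From mathcomp Require Import boolp classical_sets functions.

Local Open Scope classical_set_scope.

(** * Partial bijections as relations *)

(** Graphs ignore the irrelevant values outside [pb_dom], so that [pb_inv] and [pb_comp] become
    converse and composition of relations. *)
Definition pb_graph {T : Type} (f : pbij T) (a b : T) : Prop :=
  pb_dom f a /\ f a = b.

Lemma pb_graph_fun {T : Type} {f : pbij T} {a b c : T} :
  pb_graph f a b -> pb_graph f a c -> b = c.
Proof. by move=> [_ <-] [_ <-]. Qed.

Lemma pb_graph_inj {T : Type} {f : pbij T} {a b c : T} :
  pb_graph f a c -> pb_graph f b c -> a = b.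
Proof.
have [_ injf _] := pb_bij f.
by move=> [da <-] [db e]; apply: injf; rewrite ?inE.
Qed.

Lemma pb_rngP {T : Type} (f : pbij T) (b : T) :
  pb_rng f b <-> exists a, pb_graph f a b.
Proof.
have [subf _ surjf] := pb_bij f; split.
  by move=> rb; have [a da fab] := surjf _ rb; exists a.
by move=> [a [da <-]]; exact: subf.
Qed.

Lemma pb_graph_id {T : Type} (S : set T) (a b : T) :
  pb_graph (pb_id S) a b <-> S a /\ a = b.
Proof. by []. Qed.

Lemma pb_graph_inv {T : Type} (f : pbij T) (a b : T) :
  pb_graph (pb_inv f) a b <-> pb_graph f b a.
Proof.
have [_ injf surjf] := pb_bij f.
have invK c : pb_dom f c -> pb_inv f (f c) = c.
  by move=> dc; rewrite /= pinvKV ?inE.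
split=> [[ra ab]|[db <-]].
  by have [c dc fca] := surjf _ ra; rewrite -ab -fca invK.
by split; [apply/pb_rngP; exists b|exact: invK].
Qed.

Lemma pb_graph_comp {T : Type} (f' f : pbij T) (a c : T) :
  pb_graph (pb_comp f' f) a c <-> exists2 b, pb_graph f a b & pb_graph f' b c.
Proof.
split=> [[[da [d'a _]] <-]|[b [da fab] [d'b f'bc]]]; first by exists (f a).
split; last by rewrite /= fab.
(* The extra condition [pb_rng f] in the domain of [pb_comp] holds for every value of [f] on its
   domain. *)
by split=> //; split; rewrite fab //; apply/pb_rngP; exists a.
Qed.

(** * Ideals and graphs of ring isomorphisms *)

Lemma idealD {A : rngType} {S J : set A} : is_ideal S J ->
  forall a b, J a -> J b -> J (a + b)%R.
Proof.
move=> idJ a b Ja Jb; rewrite -[b]GRing.opprK.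
apply: (idealB idJ) => //; rewrite -GRing.sub0r.
by apply: (idealB idJ) => //; exact: ideal0 idJ.
Qed.

Lemma idealM {A : rngType} {S J : set A} : is_ideal S J ->
  forall a b, J a -> J b -> J (rmul a b).
Proof.
by move=> idJ a b Ja Jb; apply: (idealMl idJ) => //; exact: ideal_sub Ja.
Qed.

Lemma ideal_self {A : rngType} {S J : set A} : is_ideal S J -> is_ideal J J.
Proof.
move=> idJ; split=> //; first exact: ideal0 idJ.
- exact: idealB idJ.
- by move=> r a; exact: idealM idJ _ _.
- by move=> a b Ja Jb; exact: idealM idJ _ _ Jb Ja.
Qed.

Section RingIsoGraph.
Context {A : rngType} {S J K : set A} {f : pbij A}.
Hypotheses (idJ : is_ideal S J) (isof : ring_iso J K f).

Lemma ring_iso_graphD a b a' b' : pb_graph f a b -> pb_graph f a' b' ->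
  pb_graph f (a + a')%R (b + b')%R.
Proof.
have [domf _ fD _] := isof; rewrite /pb_graph domf => -[Ja <-] [Ja' <-].
by split; [exact: (idealD idJ)|exact: fD].
Qed.

Lemma ring_iso_graphM a b a' b' : pb_graph f a b -> pb_graph f a' b' ->
  pb_graph f (rmul a a') (rmul b b').
Proof.
have [domf _ _ fM] := isof; rewrite /pb_graph domf => -[Ja <-] [Ja' <-].
by split; [exact: (idealM idJ)|exact: fM].
Qed.

End RingIsoGraph.

(** * Inverses in a groupoid and the map sending g to g_x *)

Section Groupoid.
Context {G : groupoid}.

Lemma ginv_uniq {y z : gobj G} (g : ghom y z) (h : ghom z y) :
  gcomp h g = gid y -> h = ginv g.
Proof. by move=> hg; rewrite -[h]gcompg1 -(gcompgV g) gcompA hg gcomp1g. Qed.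

Lemma ginvK {y z : gobj G} (g : ghom y z) : ginv (ginv g) = g.
Proof. by apply/esym/ginv_uniq; exact: gcompgV. Qed.

Lemma ginv_id (y : gobj G) : ginv (gid y) = gid y.
Proof. by apply/esym/ginv_uniq; exact: gcomp1g. Qed.

Lemma ginv_comp {y z w : gobj G} (g : ghom z w) (h : ghom y z) :
  ginv (gcomp g h) = gcomp (ginv h) (ginv g).
Proof.
apply/esym/ginv_uniq.
by rewrite -gcompA (gcompA (ginv g)) gcompVg gcomp1g gcompVg.
Qed.

Context {x : gobj G} (tx : transversal_at x).

Lemma to_isotropy_identity {y z : gobj G} (g : ghom y z) :
  is_identity g -> to_isotropy tx g = gid x.
Proof. by case=> w; rewrite /to_isotropy gcompg1 gcompVg. Qed.

(** In g_x h_x the inner factors tau_z and its inverse meet and cancel. *)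
Lemma to_isotropy_comp {y z w : gobj G} (g : ghom z w) (h : ghom y z) :
  to_isotropy tx (gcomp g h) = gcomp (to_isotropy tx g) (to_isotropy tx h).
Proof.
rewrite /to_isotropy -!gcompA; do 2!congr gcomp.
by rewrite !gcompA gcompgV gcomp1g.
Qed.

Lemma to_isotropy_inv {y z : gobj G} (g : ghom y z) :
  to_isotropy tx (ginv g) = ginv (to_isotropy tx g).
Proof. by rewrite /to_isotropy !ginv_comp ginvK gcompA. Qed.

End Groupoid.

(** * Partial actions in terms of graphs *)

Section PartialActionGraph.
Context {G : groupoid} {A : rngType} {S : set A}.
Context {D : forall y z : gobj G, ghom y z -> set A}.
Context {alpha : forall y z : gobj G, ghom y z -> pbij A}.
Hypothesis pa : @partial_action G A S D alpha.

Lemma pa_pb_dom y z (g : ghom y z) : pb_dom (alpha y z g) = D z y (ginv g).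
Proof. by case: (pa_iso pa g). Qed.

Lemma pa_pb_rng y z (g : ghom y z) : pb_rng (alpha y z g) = D y z g.
Proof. by case: (pa_iso pa g). Qed.

Lemma pa_graph_id y a b : pb_graph (alpha y y (gid y)) a b -> a = b.
Proof. by have [_ fE] := pa_id pa y => -[da <-]; rewrite fE. Qed.

(** (P3) puts [a] in the domain of the composite, and (P4) gives the value there. *)
Lemma pa_graph_comp y z w (g : ghom z w) (h : ghom y z) a b c :
  pb_graph (alpha y z h) a b -> pb_graph (alpha z w g) b c ->
  pb_graph (alpha y w (gcomp g h)) a c.
Proof.
move=> hab [dgb gbc]; have Dhb : D y z h b.
  by rewrite -pa_pb_rng; apply/pb_rngP; exists a.
case: hab dgb gbc Dhb => dha <-; rewrite !pa_pb_dom in dha * => Dgb gbc Dhb.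
split; first by rewrite pa_pb_dom; apply: (pa_dom pa).
by rewrite -(pa_comp pa).
Qed.

(** The map of the inverse of [g] is defined at [b]; following [g] by it lands in the graph of an
    identity, so its value at [b] is [a]. *)
Lemma pa_graph_inv y z (g : ghom y z) a b :
  pb_graph (alpha y z g) a b -> pb_graph (alpha z y (ginv g)) b a.
Proof.
move=> gab; have dVb : pb_dom (alpha z y (ginv g)) b.
  by rewrite pa_pb_dom ginvK -pa_pb_rng; apply/pb_rngP; exists a.
split=> //; have Vb : pb_graph (alpha z y (ginv g)) b (alpha z y (ginv g) b) by [].
by have := pa_graph_comp _ _ _ _ _ _ _ _ gab Vb; rewrite gcompVg => /pa_graph_id.
Qed.

End PartialActionGraph.

(** * The composites transported from the isotropy group *)

Section Theta.
Context {G : groupoid} {x : gobj G} {tx : transversal_at x}.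
Context {A : rngType} {X : datum x A}.
Hypothesis DX : is_D_object tx X.

(** The composite in the second case of [theta], taken for identities as well; [u] and [v] are the
    intermediate points in I_x. *)
Definition transport_graph {y z : gobj G} (g : ghom y z) (a b : A) : Prop :=
  exists u v, [/\ pb_graph (dat_tau X y) u a,
    pb_graph (dat_iso X (to_isotropy tx g)) u v & pb_graph (dat_tau X z) v b].

Lemma dat_isoP : @partial_action (isotropy x) A (dat_ideal X x)
  (fun _ _ => dat_iso_set X) (fun _ _ => dat_iso X).
Proof. by case: (D_iso DX). Qed.

Lemma transport_graph_comp {y z w : gobj G} (g : ghom z w) (h : ghom y z) a b c :
  transport_graph h a b -> transport_graph g b c ->
  transport_graph (gcomp g h) a c.
Proof.
move=> [u [v [ua uv vb]]] [v' [t [v'b vt tc]]].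
(* Injectivity of gamma_(tau_z) identifies the two points of I_x above [b]. *)
rewrite (pb_graph_inj v'b vb) in vt.
exists u, t; split=> //; rewrite to_isotropy_comp.
exact: (pa_graph_comp dat_isoP tt tt tt _ _ _ _ _ uv vt).
Qed.

Lemma transport_graph_inv {y z : gobj G} (g : ghom y z) a b :
  transport_graph g a b -> transport_graph (ginv g) b a.
Proof.
move=> [u [v [ua uv vb]]]; exists v, u; split=> //; rewrite to_isotropy_inv.
exact: (pa_graph_inv dat_isoP tt tt _ _ _ uv).
Qed.

(** Here g_x is the identity, so [u] and [v] coincide. Only an implication holds in general: the
    composite reaches I_(tau_y), which may be smaller than I_y. *)
Lemma transport_graph_identity {y z : gobj G} (g : ghom y z) a b :
  is_identity g -> transport_graph g a b -> dat_ideal X z a /\ a = b.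
Proof.
move=> idg [u [v []]]; rewrite (to_isotropy_identity _ _ idg).
case: y z g / idg => y ua /(pa_graph_id dat_isoP tt) <- ub.
split; last exact: pb_graph_fun ua ub.
have [_ rngE _ _] := D_tau_iso DX y.
by apply: (ideal_sub (D_tau_rng DX y)); rewrite -rngE; apply/pb_rngP; exists u.
Qed.

Lemma transport_graphD {y z : gobj G} (g : ghom y z) a b a' b' :
  transport_graph g a b -> transport_graph g a' b' ->
  transport_graph g (a + a')%R (b + b')%R.
Proof.
move=> [u [v [ua uv vb]]] [u' [v' [ua' uv' vb']]].
exists (u + u')%R, (v + v')%R; split.
- exact: (ring_iso_graphD (D_tau_dom DX y) (D_tau_iso DX y)).
(* The domain of gamma_h is the ideal attached to the inverse of [h]. *)
- set h := to_isotropy tx g in uv uv' *.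
  exact: (ring_iso_graphD (@pa_ideal _ _ _ _ _ dat_isoP tt tt (ginv h))
    (@pa_iso _ _ _ _ _ dat_isoP tt tt h)).
- exact: (ring_iso_graphD (D_tau_dom DX z) (D_tau_iso DX z)).
Qed.

Lemma transport_graphM {y z : gobj G} (g : ghom y z) a b a' b' :
  transport_graph g a b -> transport_graph g a' b' ->
  transport_graph g (rmul a a') (rmul b b').
Proof.
move=> [u [v [ua uv vb]]] [u' [v' [ua' uv' vb']]].
exists (rmul u u'), (rmul v v'); split.
- exact: (ring_iso_graphM (D_tau_dom DX y) (D_tau_iso DX y)).
- set h := to_isotropy tx g in uv uv' *.
  exact: (ring_iso_graphM (@pa_ideal _ _ _ _ _ dat_isoP tt tt (ginv h))
    (@pa_iso _ _ _ _ _ dat_isoP tt tt h)).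
- exact: (ring_iso_graphM (D_tau_dom DX z) (D_tau_iso DX z)).
Qed.

(** * The maps theta_g, their ranges and their compatibilities *)

Lemma theta_graph_identity {y z : gobj G} (g : ghom y z) a b :
  is_identity g ->
  pb_graph (theta tx X g) a b <-> dat_ideal X z a /\ a = b.
Proof. by move=> idg; rewrite /theta asboolT //; exact: pb_graph_id. Qed.

Lemma theta_graph_transport {y z : gobj G} (g : ghom y z) a b :
  ~ is_identity g ->
  pb_graph (theta tx X g) a b <-> transport_graph g a b.
Proof.
move=> idg; rewrite /theta asboolF //; split.
  move=> /pb_graph_comp[v /pb_graph_comp[u /pb_graph_inv au uv] vb].
  by exists u, v.
move=> [u [v [ua uv vb]]]; apply/pb_graph_comp; exists v => //.
by apply/pb_graph_comp; exists u => //; apply/pb_graph_inv.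
Qed.

(** Valid for every [g], this inclusion brings results on composites back to [theta] even when a
    product turns out to be an identity. *)
Lemma sub_transport_theta {y z : gobj G} (g : ghom y z) a b :
  transport_graph g a b -> pb_graph (theta tx X g) a b.
Proof.
have [idg|idg] := pselect (is_identity g); last by move/theta_graph_transport; exact.
by move=> /(transport_graph_identity _ _ _ idg)/theta_graph_identity; exact.
Qed.

Lemma theta_rng_identity {y z : gobj G} (g : ghom y z) :
  is_identity g -> pb_rng (theta tx X g) = dat_ideal X z.
Proof. by move=> idg; rewrite /theta asboolT. Qed.

Lemma theta_rng_transport {y z : gobj G} (g : ghom y z) :
  ~ is_identity g -> pb_rng (theta tx X g) = transported_set tx X g.
Proof.
move=> idg; have [domy _ _ _] := D_tau_iso DX y; have [domz _ _ _] := D_tau_iso DX z.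
have domh := pa_pb_dom dat_isoP tt tt (to_isotropy tx g).
apply/seteqP; split=> [b /pb_rngP[a /(theta_graph_transport _ _ _ idg)]|b].
  move=> [u [v [[du _] [du' uv] [dv vb]]]]; exists v => //.
  rewrite -domz; split=> //; exists u => //.
  by rewrite -domy; split=> //; rewrite domh in du'.
(* The preimage under theta_g is found by pushing [u] forward along gamma_(tau_y). *)
move=> [v [dv [u [du du'] uv]] vb]; apply/pb_rngP; exists (dat_tau X y u).
apply: sub_transport_theta; exists u, v.
by split; split=> //; rewrite ?domy ?domz ?domh.
Qed.

Lemma theta_graph_inv {y z : gobj G} (g : ghom y z) a b :
  pb_graph (theta tx X g) a b -> pb_graph (theta tx X (ginv g)) b a.
Proof.
have [idg|idg] := pselect (is_identity g).
  case: y z g / idg => y; rewrite ginv_id.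
  have idy := IsIdentity y.
  by move=> /(theta_graph_identity _ _ _ idy)[Ia <-]; apply/theta_graph_identity.
move=> /(theta_graph_transport _ _ _ idg) gab.
exact/sub_transport_theta/transport_graph_inv.
Qed.

(** An identity factor moves no point. Otherwise both factors are transported composites, and so is
    their product, which may be an identity, as when [h] is inverse to [g]. *)
Lemma theta_graph_comp {y z w : gobj G} (g : ghom z w) (h : ghom y z) a b c :
  pb_graph (theta tx X h) a b -> pb_graph (theta tx X g) b c ->
  pb_graph (theta tx X (gcomp g h)) a c.
Proof.
have [idg|idg] := pselect (is_identity g).
  case: z w g / idg h => z h hab; rewrite gcomp1g.
  by move=> /(theta_graph_identity _ _ _ (IsIdentity z))[_ <-].
have [idh|idh] := pselect (is_identity h).
  case: y z h / idh g idg => y g _; rewrite gcompg1.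
  by move=> /(theta_graph_identity _ _ _ (IsIdentity y))[_ <-].
move=> /(theta_graph_transport _ _ _ idh) hab /(theta_graph_transport _ _ _ idg) gbc.
by apply: sub_transport_theta; apply: transport_graph_comp gbc.
Qed.

Lemma theta_dom {y z : gobj G} (g : ghom y z) :
  pb_dom (theta tx X g) = pb_rng (theta tx X (ginv g)).
Proof.
apply/seteqP; split=> a.
  by move=> da; apply/pb_rngP; exists (theta tx X g a); apply: theta_graph_inv.
by move=> /pb_rngP[b /theta_graph_inv]; rewrite ginvK => -[].
Qed.

Lemma theta_graphD {y z : gobj G} (g : ghom y z) a b a' b' :
  pb_graph (theta tx X g) a b -> pb_graph (theta tx X g) a' b' ->
  pb_graph (theta tx X g) (a + a')%R (b + b')%R.
Proof.
have [idg|idg] := pselect (is_identity g).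
  move=> /(theta_graph_identity _ _ _ idg)[Ia <-].
  move=> /(theta_graph_identity _ _ _ idg)[Ia' <-].
  by apply/theta_graph_identity => //; split=> //; apply: (idealD (D_ideal DX z)).
move=> /(theta_graph_transport _ _ _ idg) ab /(theta_graph_transport _ _ _ idg) ab'.
exact/sub_transport_theta/transport_graphD.
Qed.

Lemma theta_graphM {y z : gobj G} (g : ghom y z) a b a' b' :
  pb_graph (theta tx X g) a b -> pb_graph (theta tx X g) a' b' ->
  pb_graph (theta tx X g) (rmul a a') (rmul b b').
Proof.
have [idg|idg] := pselect (is_identity g).
  move=> /(theta_graph_identity _ _ _ idg)[Ia <-].
  move=> /(theta_graph_identity _ _ _ idg)[Ia' <-].
  by apply/theta_graph_identity => //; split=> //; apply: (idealM (D_ideal DX z)).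
move=> /(theta_graph_transport _ _ _ idg) ab /(theta_graph_transport _ _ _ idg) ab'.
exact/sub_transport_theta/transport_graphM.
Qed.

(** For an identity the range I_z is an ideal of itself; for other [g] this is the last condition on
    an object of D. *)
Lemma theta_rng_ideal {y z : gobj G} (g : ghom y z) :
  is_ideal (dat_ideal X z) (pb_rng (theta tx X g)).
Proof.
have [idg|idg] := pselect (is_identity g); last first.
  by rewrite theta_rng_transport //; exact: (D_transported DX).
rewrite theta_rng_identity //; exact: ideal_self (D_ideal DX z).
Qed.

End Theta.

Theorem theorem3p2 (G : groupoid) (connG : groupoid_connected G) (x : gobj G)
    (tx : transversal_at x) (A : rngType) (X : datum x A)
    (DX : is_D_object tx X) :
  [/\ forall y : gobj G, pb_rng (theta tx X (gid y)) = dat_ideal X y,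
      forall (y z : gobj G) (g : ghom y z), ~ is_identity g ->
        pb_rng (theta tx X g) = transported_set tx X g
    & partial_action [set: A]
        (fun (y z : gobj G) (g : ghom y z) => pb_rng (theta tx X g))
        (fun (y z : gobj G) (g : ghom y z) => theta tx X g)].
Proof.
have rng_id (y : gobj G) : pb_rng (theta tx X (gid y)) = dat_ideal X y.
  by apply: theta_rng_identity.
split=> //; first by move=> y z g; exact: theta_rng_transport.
split.
- by move=> y; rewrite rng_id; exact: (D_ideal DX).
- by move=> y z g; rewrite rng_id; exact: theta_rng_ideal.
(* With B of the inverse of [g] read as the domain of theta_g, additivity and multiplicativity are
   closure of the graph under sums and products. *)
- move=> y z g; rewrite -theta_dom //; split=> // a b da db.
    have [//] := @theta_graphD _ _ _ _ _ DX _ _ g a _ b _ (conj da erefl) (conj db erefl).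
  have [//] := @theta_graphM _ _ _ _ _ DX _ _ g a _ b _ (conj da erefl) (conj db erefl).
- by move=> y; rewrite rng_id /theta asboolT.
(* Composition of graphs yields (P3) from its domain half and, in the next case, (P4) from its value
   half. *)
- move=> y z w g h a; rewrite -!theta_dom // => -[da [dga _]].
  by have [] := theta_graph_comp DX g h a _ _ (conj da erefl) (conj dga erefl).
- move=> y z w g h a; rewrite -!theta_dom // => da [dga _].
  by have [_ ->] := theta_graph_comp DX g h a _ _ (conj da erefl) (conj dga erefl).
Qed.
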